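(* Let $G=(V,E)$ be a (finite) simple graph, let $k$ be a field, let $I$ be the edge ideal of $G$ over $k$, and let $L=L(I)$ be its lcm-lattice. Then $G$ is cochordal if and only if $L$ is $2$-degree graded and CL-shellable.
   Context: Graphs. The edge ideal of $G=(V,E)$ over $k$ is the ideal of $k[x_v : v\in V]$ generated by the monomials $x_ix_j$ with $\{i,j\}\in E$. The complement of $G$ is the graph $\bar G$ on $V$ whose edges are the pairs not in $E$. A graph is chordal if it has no induced cycle of length $\ge 4$. $G$ is cochordal if $\bar G$ is chordal. Lcm-lattice. For a monomial ideal $I$ with minimal set of monomial generators $G(I)$, the lcm-lattice $L(I)$ is the finite atomic lattice whose elements are the least common multiples of all subsets of $G(I)$ (the lcm of the empty set being $1$), ordered by divisibility. Its minimum is $1$, and its atoms are the elements of $G(I)$. In a poset, $a\prec b$ ($b$ covers $a$) means $a<b$ and there is no $c$ with $a<c<b$. Degree-graded. $L(I)$ is degree-graded if for all $a,b\in L(I)$ with $a\neq 1$ and $b\ne 1$, $a\prec b$ implies $\deg(b)=\deg(a)+1$ (degrees as monomials). It is $d$-degree graded if it is degree-graded and its atoms (the minimal generators of $I$) all have degree $d$. CL-shellability. A finite poset is graded if it is bounded (has a minimum $\hat 0$ and a maximum $\hat 1$) and all its maximal chains have the same length. A graded poset is CL-shellable (in the sense of Björner and Wachs) if and only if it admits a recursive atom ordering; this may be taken as the definition. A graded poset $P$ admits a recursive atom ordering if either $P\setminus\{\hat 0,\hat 1\}=\emptyset$, or there is an ordering $a_1,\dots,a_t$ of the atoms of $P$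 such that: (i) for all $1\le j\le t$ the interval $[a_j,\hat 1]$ admits a recursive atom ordering in which the atoms of $[a_j,\hat 1]$ that cover some $a_i$ with $i<j$ appear before the atoms that do not have this property; (ii) for all $1\le i<j\le t$ there exists $k<j$ such that for all $y\in P$ with $a_i,a_j\le y$ there exists $z\in P$ with $a_k\prec z$, $a_j\prec z$ and $z\le y$. *)

(* Defs.v *)
From Stdlib Require Import Classical.
From mathcomp Require Import all_boot all_order all_algebra.
From mathcomp Require Import mpoly.

Set Implicit Arguments.
Unset Strict Implicit.
Unset Printing Implicit Defensive.

Import GRing.Theory.
Local Open Scope ring_scope.

(* A finite simple graph is a symmetric irreflexive [e : rel V] on a finType. *)
Section Graphs.
Variable V : finType.
Implicit Types (e : rel V) (c : seq V).

Definition compl_graph e : rel V := fun u v => (u != v) && ~~ e u v.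

(* [c] lists the vertices in cyclic order; the edges of the subgraph induced
   on [c] are exactly the pairs of cyclically consecutive vertices. *)
Definition induced_cycle e c : Prop :=
  uniq c /\ {in c &, forall u v, e u v = (v == next c u) || (u == next c v)}.

Definition chordal e : Prop :=
  forall c, (4 <= size c)%N -> ~ induced_cycle e c.

Definition cochordal e : Prop := chordal (compl_graph e).

End Graphs.

(* A poset is given by its elements [P : T -> Prop] inside a type [T] with an
   order relation [le]; the interval [a, 1] is then a poset of the same kind. *)
Section Posets.
Variables (T : eqType) (le : rel T).
Implicit Types (P : T -> Prop) (a b x y z : T) (s t c : seq T).

Definition slt : rel T := fun x y => (x != y) && le x y.

Definition covers P a b : Prop :=
  [/\ P a, P b, slt a b & forall x, P x -> ~ (slt a x /\ slt x b)].

Definition is_bottom P a : Prop := P a /\ forall x, P x -> le a x.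
Definition is_top P a : Prop := P a /\ forall x, P x -> le x a.

Definition is_atom P a : Prop := exists2 b, is_bottom P b & covers P b a.

Definition maximal_chain P c : Prop :=
  [/\ sorted slt c, forall x, x \in c -> P x &
      forall x, P x -> (forall y, y \in c -> le x y \/ le y x) -> x \in c].

Definition graded_poset P : Prop :=
  [/\ exists s, forall x, P x -> x \in s,
      exists a, is_bottom P a,
      exists a, is_top P a &
      forall c c', maximal_chain P c -> maximal_chain P c' -> size c = size c'].

(* The interval [a, 1] of [P], where 1 is the maximum of [P]. *)
Definition upper_interval P a : T -> Prop := fun x => P x /\ le a x.

Definition enumerates_atoms P s : Prop :=
  uniq s /\ forall a, a \in s <-> is_atom P a.

Definition before s a b : Prop :=
  [/\ a \in s, b \in s & (index a s < index b s)%N].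

Definition covers_earlier P s a x : Prop :=
  exists2 b, before s b a & covers P b x.

(* [recursive_atom_ordering P s]: [s] is a recursive atom ordering of [P].
   When [P] is contained in {0, 1} it has at most one atom, and its only
   enumeration is accepted. *)
Inductive recursive_atom_ordering : (T -> Prop) -> seq T -> Prop :=
| RAO_trivial P s of
    enumerates_atoms P s
  & (forall x, P x -> is_bottom P x \/ is_top P x) :
    recursive_atom_ordering P s
| RAO_step P s of
    enumerates_atoms P s
  & (forall a, a \in s ->
       exists2 t, recursive_atom_ordering (upper_interval P a) t &
         forall x y, x \in t -> y \in t ->
           covers_earlier P s a x -> ~ covers_earlier P s a y -> before t x y)
  & (forall a b, before s a b ->
       exists2 c, before s c b &
         forall y, P y -> le a y -> le b y ->
           exists z, [/\ covers P c z, covers P b z & le z y]) :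
    recursive_atom_ordering P s.

Definition CL_shellable P : Prop :=
  graded_poset P /\ exists s, recursive_atom_ordering P s.

End Posets.

Section Ideals.

Definition ideal_gen (R : comNzRingType) (S : R -> Prop) (p : R) : Prop :=
  exists (r : nat) (c g : 'I_r -> R),
    (forall i, S (g i)) /\ p = \sum_(i < r) c i * g i.

Variables (k : fieldType) (n : nat).
Implicit Types (I : {mpoly k[n]} -> Prop) (m : 'X_{1..n}).

Definition monomials_of (M : 'X_{1..n} -> Prop) : {mpoly k[n]} -> Prop :=
  fun p => exists2 m, M m & p = 'X_[m].

(* G(I), as the set of monomials of [I] that are minimal for divisibility;
   [min_gensP] below shows that, for a monomial ideal, it generates [I] and is
   contained in every generating set of monomials. *)
Definition min_gens I m : Prop :=
  I 'X_[m] /\ forall m', I 'X_[m'] -> (m' <= m)%MM -> m' = m.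

(* In [mpoly], [(m <= m')%MM], i.e. [lem m m'], is divisibility of
   monomials, and [0%MM] is the monomial 1. *)
Definition lcm_lattice I m : Prop :=
  exists2 s : seq 'X_{1..n}, forall g, g \in s -> min_gens I g
    & m = \big[@mlcm n/0%MM]_(g <- s) g.

Definition degree_graded I : Prop :=
  forall a b, a <> 0%MM -> b <> 0%MM ->
    covers (@lem n) (lcm_lattice I) a b -> mdeg b = (mdeg a).+1.

Definition d_degree_graded (d : nat) I : Prop :=
  degree_graded I /\
  forall a, is_atom (@lem n) (lcm_lattice I) a -> mdeg a = d.

Lemma min_gensP I (M : 'X_{1..n} -> Prop) :
  (forall p, I p <-> ideal_gen (monomials_of M) p) ->
  (forall p, I p <-> ideal_gen (monomials_of (min_gens I)) p) /\
  (forall m, min_gens I m -> M m).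
Proof.
move=> IM.
have gen_in (S : {mpoly k[n]} -> Prop) (c g : {mpoly k[n]}) : S g -> ideal_gen S (c * g).
  move=> Sg; exists 1%N, (fun=> c), (fun=> g); split=> //.
  by rewrite big_ord1.
have IX m : M m -> I 'X_[m].
  by move=> Mm; apply/IM; rewrite -['X_[m]]mul1r; apply: gen_in; exists m.
have mulI (c p : {mpoly k[n]}) : I p -> I (c * p).
  move=> /IM[r [d [g [Sg ->]]]]; apply/IM.
  exists r, (fun i => c * d i), g; split=> //.
  by rewrite mulr_sumr; apply: eq_bigr => i _; rewrite mulrA.
have addI (p q : {mpoly k[n]}) : I p -> I q -> I (p + q).
  move=> /IM[r [d [g [Sg ->]]]] /IM[r' [d' [g' [Sg' ->]]]]; apply/IM.
  pose f T (u : 'I_r -> T) u' (i : 'I_(r + r')) : T :=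
    match split i with inl j => u j | inr j => u' j end.
  exists (r + r')%N, (f _ d d'), (f _ g g'); split.
    by move=> i; rewrite /f; case: (split i).
  rewrite big_split_ord /=; congr (_ + _); apply: eq_bigr => i _.
    by rewrite /f (unsplitK (inl i)).
  by rewrite /f (unsplitK (inr i)).
have I0 : I 0.
  apply/IM; exists 0%N, (fun=> 0), (fun=> 0); split; first by case.
  by rewrite big_ord0.
have min_below m : I 'X_[m] -> exists2 g, min_gens I g & (g <= m)%MM.
  have [d] := ubnP (mdeg m); elim: d m => // d IH m /[!ltnS] led Im.
  have [mm|nmm] := classic (min_gens I m); first by exists m; rewrite ?lepm_refl.
  have [m' [Im' lem' nem']] : exists m', [/\ I 'X_[m'], (m' <= m)%MM & m' <> m].
    apply: NNPP => nex; apply: nmm; split=> // m' Im' lem'.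
    by apply: NNPP => ne; apply: nex; exists m'.
  have dlt : (mdeg m' < mdeg m)%N.
    rewrite -(submK lem') mdegD -[X in (X < _)%N]add0n ltn_add2r lt0n mdeg_eq0.
    by apply/eqP=> e0; apply: nem'; rewrite -(submK lem') e0 add0m.
  have [g gm leg] := IH m' (leq_trans dlt led) Im'.
  by exists g => //; apply: lepm_trans leg lem'.
split=> [p|m [Im minm]].
  split=> [/IM[r [c [g [Sg ->]]]]|[r [c [g [Sg ->]]]]]; last first.
    elim/big_ind: _ => //= i _; apply: mulI.
    by have [m [Im _] ->] := Sg i.
  have H i : exists h : {mpoly k[n]} * {mpoly k[n]},
      monomials_of (min_gens I) h.2 /\ g i = h.1 * h.2.
    have [m Mm ->] := Sg i; have [g' g'min g'm] := min_below m (IX _ Mm).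
    exists ('X_[m - g'], 'X_[g']); split; first by exists g'.
    by rewrite /= -mpolyXD submK.
  have [h hP] := fin_all_exists H.
  exists r, (fun i => c i * (h i).1), (fun i => (h i).2); split.
    by move=> i; case: (hP i).
  by apply: eq_bigr => i _; case: (hP i) => _ ->; rewrite mulrA.
have /IM[r [c [g [Sg Xm]]]] := Im.
have : \sum_(i < r) (c i * g i)@_m != 0.
  by rewrite -raddf_sum /= -Xm mcoeffX eqxx oner_neq0.
have [[i nz]|nex] := classic (exists i, (c i * g i)@_m != 0); last first.
  rewrite big1 ?eqxx // => i _; apply/eqP/negPn/negP => nz.
  by apply: nex; exists i.
move=> _; have [m' Mm' gE] := Sg i.
move: nz; rewrite gE -mcoeff_msupp (perm_mem (msuppMX _ _)) => /mapP[q _ mE].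
by rewrite -(minm m' (IX _ Mm')) // mE ?lem_addr // lem_addl.
Qed.

End Ideals.

(* k[x_v : v in V] is {mpoly k[#|V|]}, with x_v the variable of index
   [enum_rank v]. *)
Definition edge_ideal (k : fieldType) (V : finType) (e : rel V) :
    {mpoly k[#|V|]} -> Prop :=
  ideal_gen (fun p => exists u v : V,
    e u v /\ p = 'X_(enum_rank u) * 'X_(enum_rank v)).
Arguments edge_ideal k [V] e _.

(* Main.v *)
Require Import Defs.
From Stdlib Require Import Classical.
From mathcomp Require Import all_boot all_order all_algebra.
From mathcomp Require Import mpoly zify.

Set Implicit Arguments.
Unset Strict Implicit.
Unset Printing Implicit Defensive.

(* The lcm-lattice consists of the squarefree monomials of the vertex sets U
   such that G[U] has no isolated vertex.

   If the lattice is 2-degree graded, condition (ii) of a recursive atom ordering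
   says that for disjoint edges A before B some edge before B joins A to B. In
   an induced cycle of the complement, cut along the chord that is the latest
   edge of G: the chord becomes a side of a shorter cycle whose chords still
   precede all its sides, and a cycle of length 4 is impossible.

   Conversely, a chordal complement has a perfect elimination ordering (Dirac).
   Two disjoint edges of G are then joined by an edge, so every cover above a
   nonzero element adds exactly one vertex and the upper intervals of nonzero
   elements are semimodular, whence all their atom orderings are recursive.
   Ordering the edges by their first vertex in the elimination ordering gives
   condition (ii) for the whole lattice. *)

(** * Cycles *)

(* [i < j < n] are cyclically consecutive modulo [n]. *)
Definition cyc_adj n i j := (j == i.+1) || ((i == 0) && (j.+1 == n)).

Section Cycles.
Variable V : finType.
Implicit Types (h : rel V) (c : seq V).

Lemma next_nthE c x0 i : uniq c -> i < size c ->
  next c (nth x0 c i) = nth x0 c (if i.+1 == size c then 0 else i.+1).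
Proof.
move=> Uc lti; rewrite next_nth mem_nth // index_uniq //.
case: c Uc lti => //= y c /andP[_ Uc] lti.
case: eqP => [[E]|ne]; first by rewrite nth_default // -E.
by apply: set_nth_default; lia.
Qed.

(** Symmetry leaves only the pairs [i < j], and the diagonal agrees because a vertex of a cycle of
    length at least 3 is not its own successor. Adjacency thereby becomes arithmetic on positions,
    which [lia] decides. *)
Lemma induced_cycle_nthP h c x0 :
    ssrbool.symmetric h -> irreflexive h -> uniq c -> 2 < size c ->
  induced_cycle h c <->
  forall i j, i < j -> j < size c ->
    h (nth x0 c i) (nth x0 c j) = cyc_adj (size c) i j.
Proof.
move=> h_sym h_irr Uc c3.
have ltS i : i < size c -> (if i.+1 == size c then 0 else i.+1) < size c.
  by case: (i.+1 =P size c); lia.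
have adjE i j : i < j -> j < size c ->
    (nth x0 c j == next c (nth x0 c i)) || (nth x0 c i == next c (nth x0 c j))
    = cyc_adj (size c) i j.
  move=> ij jc; have ic := ltn_trans ij jc.
  rewrite !next_nthE ?nth_uniq ?ltS // /cyc_adj.
  by case: (i.+1 =P size c) => ?; case: (j.+1 =P size c) => ?; lia.
split=> [[_ hc] i j ij jc|hc].
  by have ic := ltn_trans ij jc; rewrite hc ?mem_nth ?adjE.
split=> // u v /(nthP x0)[i ic <-] /(nthP x0)[j jc <-].
case: (ltngtP i j) => [ij|ji|<-].
- by rewrite hc ?adjE.
- by rewrite h_sym orbC hc ?adjE.
- rewrite h_irr next_nthE // nth_uniq ?ltS // orbb.
  by case: (i.+1 =P size c); lia.
Qed.

(* The latest chord splits the cycle into two shorter cycles with the same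
   property, one of which has length at least 4 unless [n = 4]. *)
Lemma chords_before_sides (tau : {set V} -> nat) (N n : nat) (f : nat -> V) :
    (forall A B, tau A < N -> tau A = tau B -> A = B) ->
    (forall x y u v, [disjoint [set x; y] & [set u; v]] ->
       tau [set x; y] < tau [set u; v] -> tau [set u; v] < N ->
       exists a b, [/\ a \in [set x; y], b \in [set u; v] &
                       tau [set a; b] < tau [set u; v]]) ->
    3 < n -> (forall i j, i < n -> j < n -> f i = f j -> i = j) ->
    (forall i j, i < j -> j < n -> ~~ cyc_adj n i j -> tau [set f i; f j] < N) ->
    (forall i j k l, i < j -> j < n -> ~~ cyc_adj n i j ->
       k < l -> l < n -> cyc_adj n k l ->
       tau [set f i; f j] < tau [set f k; f l]) ->
  False.
Proof.
move=> tau_inj tau_cross; elim/ltn_ind: n f => n IH f n4 f_inj chordN chord_lt.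
have set2f_inj i j k l : i < j -> j < n -> k < l -> l < n ->
    [set f i; f j] = [set f k; f l] -> i = k /\ j = l.
  move=> ij jn kl ln E.
  have : f i \in [set f k; f l] by rewrite -E set21.
  have : f j \in [set f k; f l] by rewrite -E set22.
  by rewrite !in_set2 => /orP[]/eqP/f_inj Ej /orP[]/eqP/f_inj Ei; lia.
have [n4E|n5] : n = 4 \/ 4 < n by lia.
  have disj i j k l : i < n -> j < n -> k < n -> l < n ->
      [&& i != k, i != l, j != k & j != l] ->
      [disjoint [set f i; f j] & [set f k; f l]].
    move=> in_ jn kn ln /and4P[ik il jk jl].
    rewrite disjoints_subset; apply/subsetP=> z; rewrite !inE negb_or.
    have ne a b : a < n -> b < n -> a != b -> f a != f b.
      by move=> an bn; apply: contra => /eqP/f_inj ->.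
    by case/orP=> /eqP ->; rewrite !ne.
  (* Among four positions the sides are the pairs with odd sum, the chords those with even sum. *)
  have side i j k l : i < 4 -> j < 4 -> k < l -> l < 4 ->
      odd (i + j) -> ~~ odd (k + l) -> tau [set f k; f l] < tau [set f i; f j].
    wlog ij : i j / i < j.
      move=> H i4 j4 kl l4 oij okl.
      have [ij|ji|E] := ltngtP i j; first exact: H.
        by rewrite [X in _ < tau X]setUC; apply: H => //; lia.
      by subst; lia.
    by move=> *; apply: chord_lt; rewrite /cyc_adj; lia.
  (* The two diagonals are disjoint, so [tau_cross] gives a pair joining them that comes before the
     later one. That pair is a side, whereas every side comes after every chord. *)
  have absurd i j k l : i < j -> j < 4 -> k < l -> l < 4 ->
      ~~ odd (i + j) -> ~~ odd (k + l) -> odd (i + k) ->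
      tau [set f i; f j] < tau [set f k; f l] -> False.
    move=> ij j4 kl l4 oij okl oik lt.
    have := tau_cross _ _ _ _ _ lt.
    case; [by apply: disj; lia | by apply: chordN; rewrite /cyc_adj; lia |].
    move=> a [b []]; rewrite !in_set2 => Ha Hb; apply/negP; rewrite -leqNgt ltnW //.
    by case/orP: Ha => /eqP ->; case/orP: Hb => /eqP ->; apply: side; lia.
  have := ltngtP (tau [set f 0; f 2]) (tau [set f 1; f 3]); case=> H.
  - exact: (absurd 0 2 1 3).
  - exact: (absurd 1 3 0 2).
  - have := tau_inj _ _ _ H; case/(_ _)/set2f_inj; try lia.
    by apply: chordN; rewrite /cyc_adj; lia.
pose chord (p : 'I_n * 'I_n) := (p.1 < p.2) && ~~ cyc_adj n p.1 p.2.
have n_gt2 : 2 < n by lia. have n_gt0 : 0 < n by lia.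
have chord0 : chord (Ordinal n_gt0, Ordinal n_gt2).
  by rewrite /chord /cyc_adj /=; lia.
case: (arg_maxnP (fun p : 'I_n * 'I_n => tau [set f p.1; f p.2]) chord0) => -[[i ltin] [j ltjn]].
rewrite /chord /= => /andP[ij nadj] maxij.
have max_lt k l : k < l -> l < n -> ~~ cyc_adj n k l -> (k, l) != (i, j) ->
    tau [set f k; f l] < tau [set f i; f j].
  move=> kl ln nkl ne; have kn : k < n by lia.
  have := maxij (Ordinal kn, Ordinal ln); rewrite /= kl nkl => /(_ isT).
  rewrite leq_eqVlt => /orP[/eqP/tau_inj E|//].
  have [Ek El] := set2f_inj _ _ _ _ kl ln ij ltjn (E (chordN _ _ kl ln nkl)).
  by rewrite Ek El eqxx in ne.
(* If the chord spans at least three steps, positions [i] to [j] form the shorter cycle, closed by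
   the chord. Each chord of it is an old chord other than [(i, j)], so maximality puts it before the
   new side. *)
have [ge3|lt3] := leqP 3 (j - i).
  apply: (IH (j - i).+1 _ (fun k => f (i + k))) => //.
  - by move: nadj; rewrite /cyc_adj; lia.
  - by move=> k l km lm /f_inj E; lia.
  - by move=> k l kl lm nkl; apply: chordN; move: nkl nadj; rewrite /cyc_adj; lia.
  move=> k l k' l' kl lm nkl kl' lm' akl'.
  have [|Ns] := boolP (cyc_adj n (i + k') (i + l')).
    by apply: chord_lt; move: nkl nadj; rewrite /cyc_adj; lia.
  have -> : [set f (i + k'); f (i + l')] = [set f i; f j].
    by congr [set f _; f _]; move: akl' Ns; rewrite /cyc_adj; lia.
  by apply: max_lt; rewrite ?xpair_eqE; move: nkl nadj; rewrite /cyc_adj; lia.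
have {lt3}jE : j = i.+2 by move: nadj; rewrite /cyc_adj; lia.
(* The chord now cuts off a triangle: [g] skips position [i.+1], and the [n.-1] remaining vertices
   still number at least 4. *)
pose g k := if k <= i then k else k.+1.
have gE k : k <= i /\ g k = k \/ i < k /\ g k = k.+1.
  by rewrite /g; case: leqP; [left | right].
apply: (IH n.-1 _ (f \o g)) => //=; try lia.
- by move=> k l km lm /f_inj E; have := gE k; have := gE l; lia.
- move=> k l kl lm nkl; have := gE k; have := gE l.
  by move=> ? ?; apply: chordN; move: nkl nadj; rewrite /cyc_adj; lia.
move=> k l k' l' kl lm nkl kl' lm' akl'.
have := gE k; have := gE l; have := gE k'; have := gE l' => ? ? ? ?.
have [|Ns] := boolP (cyc_adj n (g k') (g l')).
  by apply: chord_lt; move: nkl nadj akl'; rewrite /cyc_adj; lia.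
have -> : [set f (g k'); f (g l')] = [set f i; f j].
  by congr [set f _; f _]; move: akl' Ns; rewrite /cyc_adj; lia.
by apply: max_lt; rewrite ?xpair_eqE; move: nkl nadj; rewrite /cyc_adj; lia.
Qed.
End Cycles.

(** * Chordal graphs *)

Section Chordal.
Variable V : finType.
Implicit Types (h : rel V) (S : {set V}).

(** A path of minimal length works: an edge that skips vertices would shorten it. *)
Lemma chordless_path (T : finType) (r : rel T) a b : connect r a b ->
  exists p, [/\ path r a p, last a p = b, uniq (a :: p) &
    forall i j, i < j -> j <= size p ->
      r (nth a (a :: p) i) (nth a (a :: p) j) -> j = i.+1].
Proof.
case/connectP=> p0 rp0 lp0.
pose ex_path n := [exists p : n.-tuple T, path r a p && (last a p == b)].
have exn : exists n, ex_path n.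
  by exists (size p0); apply/existsP; exists (in_tuple p0); rewrite rp0 -lp0 eqxx.
case: (ex_minnP exn) => n /existsP[p1 /andP[rp1 /eqP lp1]] minn.
have min p : path r a p -> last a p = b -> n <= size p.
  move=> rp lp; apply: minn; apply/existsP.
  by exists (in_tuple p); rewrite rp lp eqxx.
(* Removing repetitions does not lengthen the path, so the result is still of minimal length. *)
case/shortenP: rp1 lp1 => p rp Up sub lp.
have sp : size p <= n.
  by rewrite -(size_tuple p1); apply: uniq_leq_size sub; case/andP: Up.
exists p; split=> // i j ij jp rij.
apply/eqP; rewrite eqn_leq ij andbT leqNgt; apply/negP=> ij2.
have lasti : last a (take i p) = nth a (a :: p) i.
  case: i ij {rij ij2} => [|i] ij; first by rewrite take0.
  by rewrite (last_nth a) size_takel /= ?nth_take // (leq_trans (ltnW ij) jp).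
have E : drop j.-1 p = nth a (a :: p) j :: drop j p.
  by case: j ij jp {rij ij2} => // j _ jp; rewrite /= (drop_nth a).
(* This is the shortcut from position [i] straight to position [j]. Positions count in [a :: p], one
   ahead of those in [p], whence [j.-1]. *)
have : n <= size (take i p ++ drop j.-1 p).
  apply: min.
    rewrite cat_path take_path //= lasti E /= rij /=.
    move: rp; rewrite -{1}(cat_take_drop j.-1 p) cat_path E.
    by case/and3P.
  move: lp; rewrite -{1}(cat_take_drop j.-1 p) last_cat E => <-.
  by rewrite last_cat lasti.
by move: sp jp; rewrite size_cat size_take_min size_drop; move: (size p) => ? ? ?; lia.
Qed.

(** If [a] and [b] were not adjacent, a chordless path between them through [D] would close up at
    [v] to an induced cycle of length at least 4, since [v] is adjacent to no vertex of the path but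
    its ends. *)
Lemma no_hole h v a b (D : {set V}) :
    ssrbool.symmetric h -> irreflexive h -> chordal h ->
    h v a -> h v b -> a != b ->
    (forall d, d \in D -> d != v /\ ~~ h v d) ->
    connect [rel x y | [&& h x y, x \in a |: (b |: D) & y \in a |: (b |: D)]] a b ->
  h a b.
Proof.
move=> h_sym h_irr h_ch va vb ab Dv /chordless_path[p [rp lp Up ch]].
apply/negPn/negP=> nab.
have stepP := pathP a rp.
have aD : a \in a |: (b |: D) by rewrite setU11.
have pD x : x \in p -> x \in a |: (b |: D).
  by case/(nthP a)=> k /stepP /and3P[_ _ ?] <-.
have apD k : k <= size p -> nth a (a :: p) k \in a |: (b |: D).
  by case: k => [|k] // kp; exact/pD/mem_nth.
have nthb : nth a (a :: p) (size p) = b by rewrite -last_nth.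
(* As [a] and [b] are distinct and not adjacent, the path has at least three vertices, and the cycle
   through [v] at least four. *)
have p2 : 1 < size p.
  case: p {ch Up pD apD} rp lp stepP nthb => [|y [|z p]] //=.
    by move=> _ E; rewrite E eqxx in ab.
  by move=> /andP[/and3P[hay _ _] _] E; rewrite -E hay in nab.
have Uc : uniq (v :: a :: p).
  rewrite cons_uniq Up andbT inE negb_or; apply/andP; split.
    by apply/eqP=> E; rewrite E h_irr in va.
  apply/negP=> /pD; rewrite !inE => /or3P[/eqP E|/eqP E|/Dv[]].
  - by rewrite E h_irr in va.
  - by rewrite E h_irr in vb.
  - by rewrite eqxx.
apply: (h_ch (v :: a :: p)); first by rewrite /=; lia.
have c3 : 2 < size (v :: a :: p) by rewrite /=; lia.
apply/(induced_cycle_nthP a h_sym h_irr Uc c3) => -[|i] [|j] // ij jp; rewrite !ltnS in ij jp.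
  have [->|j0] := eqVneq j 0; first exact: va.
  have [->|jp'] := eqVneq j (size p).
    by rewrite [nth _ _ _.+1]nthb [nth _ _ 0]/= vb /cyc_adj /= eqxx orbT.
  have -> : cyc_adj (size (v :: a :: p)) 0 j.+1 = false by rewrite /cyc_adj /=; lia.
  apply/negbTE; suff /Dv[] : nth a (a :: p) j \in D by [].
  have neA : (nth a (a :: p) j == a) = false.
    by rewrite [X in _ == X](_ : a = nth a (a :: p) 0) // nth_uniq ?ltnS // (negbTE j0).
  have neB : (nth a (a :: p) j == b) = false.
    by rewrite -nthb nth_uniq ?ltnS // (negbTE jp').
  by have := apD j jp; rewrite !inE neA neB.
rewrite (_ : cyc_adj _ _ _ = (j == i.+1)); last by rewrite /cyc_adj; lia.
rewrite [nth _ _ i.+1]/= [nth _ _ j.+1]/=.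
apply/idP/eqP=> [hij|E].
  by apply: ch => //; apply/and3P; rewrite hij !apD // (leq_trans (ltnW ij) jp).
have ip : i < size p by rewrite -E.
by rewrite E; have /and3P[] := stepP i ip.
Qed.

(** Dirac's argument by induction on [#|S|]. Asking that the simplicial vertex [s] be far from a
    prescribed [v] allows the induction hypothesis to place it on the right side of a separator. *)
Lemma simplicial_far h S v : ssrbool.symmetric h -> irreflexive h -> chordal h ->
    v \in S -> (exists2 w, w \in S & (w != v) && ~~ h v w) ->
  exists s, [/\ s \in S, s != v, ~~ h v s &
    {in S &, forall x y, h s x -> h s y -> x != y -> h x y}].
Proof.
move=> h_sym h_irr h_ch; have [m] := ubnP #|S|; elim: m S v => // m IH S v.
move=> Sm vS [w0 w0S /andP[w0v vw0]].
(* [C] is the component of [w0] among the non-neighbours of [v], and [B] is the set of neighbours of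
   [v] that touch [C]; thus [B] separates [C] from [v]. *)
pose R := [set x in S | (x != v) && ~~ h v x].
pose rR := [rel x y | [&& h x y, x \in R & y \in R]].
pose C := [set x in R | connect rR w0 x].
pose B := [set b in S | h v b && [exists c in C, h b c]].
have rR_sym : ssrbool.symmetric rR.
  by move=> x y; rewrite /= h_sym [(x \in R) && _]andbC.
have inC x : (x \in C) = (x \in R) && connect rR w0 x by rewrite in_set.
have w0C : w0 \in C by rewrite !inE w0S w0v vw0 connect0.
have CS x : x \in C -> [/\ x \in S, x != v & ~~ h v x].
  by rewrite !inE => /andP[/and3P[]].
have nbrC c x : c \in C -> x \in S -> h c x -> x \in C :|: B.
  move=> cC xS cx; have [cS cv vc] := CS c cC; rewrite inE.
  have [vx|vx] := boolP (h v x).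
    rewrite [x \in B]inE xS vx orbC /=.
    by apply/orP; left; apply/existsP; exists c; rewrite cC h_sym.
  have xR : x \in R.
    by rewrite inE xS vx andbT; apply/eqP=> E; rewrite h_sym -E cx in vc.
  move: cC; rewrite inC => /andP[cR w0c].
  by rewrite inC xR (connect_trans w0c) // connect1 //= cx cR.
(* Two vertices of [B] are joined by a path through [C], hence through non-neighbours of [v]. *)
have B_clique : {in B &, forall a b, a != b -> h a b}.
  move=> a b; rewrite !inE => /and3P[aS va /existsP[c /andP[cC ac]]].
  move=> /and3P[bS vb /existsP[d /andP[dC bd]]] ab.
  apply: (no_hole h_sym h_irr h_ch va vb ab (D := R)).
    by move=> x; rewrite inE => /and3P[].
  set r := [rel x y | _].
  have sub : subrel rR r.
    by move=> x y /and3P[/= -> xR yR]; rewrite !in_setU1 xR yR !orbT.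
  move: cC dC; rewrite !inC => /andP[cR w0c] /andP[dR w0d].
  have cd : connect rR c d by apply: connect_trans w0d; rewrite (sym_connect_sym rR_sym).
  apply: (@connect_trans _ _ c); first by rewrite connect1 //= ac !in_setU1 cR eqxx !orbT.
  apply: (@connect_trans _ _ d); last first.
    by rewrite connect1 //= h_sym bd !in_setU1 dR eqxx !orbT.
  by apply: connect_sub cd => x y /sub /connect1.
have S'S : C :|: B \subset S.
  by apply/subsetP=> x; rewrite inE => /orP[/CS[]|]; rewrite // inE => /andP[].
have S'm : #|C :|: B| < m.
  rewrite -ltnS; apply: leq_trans Sm; rewrite ltnS; apply: proper_card.
  apply/properP; split=> //; exists v => //.
  by rewrite !inE eqxx h_irr !andbF.
(* All neighbours in [S] of a vertex of [C] lie in [C :|: B], so it is enough to find a vertex of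
   [C] that is simplicial in this smaller set. *)
have simplC s : s \in C ->
    {in C :|: B &, forall x y, h s x -> h s y -> x != y -> h x y} ->
    exists s, [/\ s \in S, s != v, ~~ h v s &
      {in S &, forall x y, h s x -> h s y -> x != y -> h x y}].
  move=> sC sP; exists s; have [sS sv vs] := CS s sC; split=> // x y xS yS sx sy.
  by apply: sP => //; apply: nbrC sC _ _.
pose nonuniv := [pred w | [exists x in C :|: B, (x != w) && ~~ h w x]].
have far w : w \in C :|: B -> nonuniv w ->
    exists s, [/\ s \in C :|: B, s != w, ~~ h w s &
      {in C :|: B &, forall x y, h s x -> h s y -> x != y -> h x y}].
  by move=> wS' /existsP[x /andP[xS' xw]]; apply: IH => //; exists x.
(* A vertex far from some [b] in [B] lies in [C], because [B] is a clique. *)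
have [/existsP[b /andP[bB bn]]|univB] := boolP [exists b in B, nonuniv b].
  have [|s [sS' sb bs sP]] := far b _ bn; first by rewrite inE bB orbT.
  move: (sS'); rewrite inE => /orP[sC|sB]; first exact: simplC sC sP.
  by rewrite B_clique // eq_sym in bs.
(* Now every vertex of [B] is adjacent to all others in [C :|: B], so a vertex far from [w] lies in
   [C]. *)
have [/existsP[w /andP[wC wn]]|univC] := boolP [exists w in C, nonuniv w].
  have [|s [sS' sw ws sP]] := far w _ wn; first by rewrite inE wC.
  move: (sS'); rewrite inE => /orP[sC|sB]; first exact: simplC sC sP.
  case/negP: univB; apply/existsP; exists s; rewrite sB; apply/existsP; exists w.
  by rewrite inE wC eq_sym sw h_sym ws.
(* In the remaining case [C :|: B] is a clique, and [w0] itself is simplicial. *)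
apply: (simplC w0 w0C) => x y xS' yS' _ _ xy; apply/negPn/negP => nxy.
have xn : nonuniv x by apply/existsP; exists y; rewrite yS' eq_sym xy.
move: xS'; rewrite inE => /orP[xC|xB].
  by case/negP: univC; apply/existsP; exists x; rewrite xC.
by case/negP: univB; apply/existsP; exists x; rewrite xB.
Qed.

(** A simplicial vertex is put first and the rest is ordered by induction. Such a vertex comes from
    [simplicial_far], or is arbitrary when the graph on [S] is complete. *)
Lemma chordal_peo h S : ssrbool.symmetric h -> irreflexive h -> chordal h ->
  exists p, [/\ uniq p, p =i S &
    {in S & &, forall x y z, index x p < index y p -> index x p < index z p ->
      h x y -> h x z -> y != z -> h y z}].
Proof.
move=> h_sym h_irr h_ch; have [m] := ubnP #|S|; elim: m S => // m IH S Sm.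
have [->|[v vS]] := set_0Vmem S.
  by exists [::]; split=> // x; rewrite ?inE.
have [s sS sP] : exists2 s, s \in S &
    {in S &, forall x y, h s x -> h s y -> x != y -> h x y}.
  have [/existsP[w /andP[wS wn]]|univ] :=
      boolP [exists w in S, [exists x in S, (x != w) && ~~ h w x]].
    have [x xS xw] : exists2 x, x \in S & (x != w) && ~~ h w x.
      by case/existsP: wn => x /andP[]; exists x.
    have [|s [sS _ _ sP]] := simplicial_far h_sym h_irr h_ch wS; first by exists x.
    by exists s.
  exists v => // x y xS yS _ _ xy; apply/negPn/negP => nxy; case/negP: univ.
  apply/existsP; exists x; rewrite xS; apply/existsP; exists y.
  by rewrite yS eq_sym xy.
have [|p [Up pS pP]] := IH (S :\ s).
  by rewrite -ltnS; apply: leq_trans Sm; rewrite ltnS (cardsD1 s S) sS.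
exists (s :: p); split.
- by rewrite /= Up pS !inE eqxx.
- by move=> x; rewrite !inE pS !inE; case: eqP => // ->.
move=> x y z xS yS zS /=.
have [<-|sx] := eqVneq s x; first by move=> _ _; apply: sP.
case: (eqVneq s y) => // sy; case: (eqVneq s z) => // sz; rewrite !ltnS.
by apply: pP; rewrite !inE eq_sym ?sx ?sy ?sz.
Qed.
End Chordal.

(** * Posets *)

(** Being an atom is a [Prop], so lists of atoms are obtained by excluded middle. *)
Lemma classical_filter (T : eqType) (s : seq T) (Q : T -> Prop) :
  exists t, uniq t /\ forall x, x \in t <-> x \in s /\ Q x.
Proof.
elim: s => [|x s [t [Ut tP]]]; first by exists [::]; split=> // x; split=> // -[].
have [[xQ xt]|nxQ] := classic (Q x /\ x \notin t).
  exists (x :: t); split=> [|y]; first by rewrite /= xt.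
  rewrite !inE; split=> [/predU1P[->|/tP[-> ?]]|[/predU1P[->|ys] Qy]].
  - by rewrite eqxx.
  - by rewrite orbT.
  - by rewrite eqxx.
  - by apply/orP; right; apply/tP.
exists t; split=> // y; rewrite inE; split=> [/tP[-> ?]|]; first by rewrite orbT.
case=> /predU1P[->|ys] Qy; last exact/tP.
by apply/negPn/negP => nyt; apply: nxQ.
Qed.

(** Each element is inserted at the front or at the back according to [Q]. *)
Lemma classical_partition (T : eqType) (s : seq T) (Q : T -> Prop) : uniq s ->
  exists t, [/\ uniq t, t =i s &
    forall x y, x \in t -> y \in t -> Q x -> ~ Q y -> before t x y].
Proof.
elim: s => [|x s IH] /=; first by exists [::].
case/andP=> xs /IH[t [Ut ts tP]]; have [Qx|nQx] := classic (Q x).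
  exists (x :: t); split=> [|y|y z]; rewrite /= ?inE ?ts ?xs // => ys zs Qy nQz.
  have zt : z \in t by case/predU1P: zs nQz => [->|]; rewrite ?ts.
  have zx : (x == z) = false by apply/eqP => E; case: nQz; rewrite -E.
  rewrite /before !inE ts ys zt orbT; split=> //=; rewrite zx.
  have [//|yx] := eqVneq x y; case/predU1P: ys => [E|ys].
    by rewrite E eqxx in yx.
  by have [|//|//|//|_ _ lt] := tP y z; rewrite ?ts.
exists (rcons t x); split=> [|y|y z]; rewrite ?rcons_uniq ?ts ?xs // ?mem_rcons ?inE ?ts //.
move=> ys zs Qy nQz; rewrite /before !mem_rcons !inE !ts; split=> //.
have yt : y \in t by case/predU1P: ys Qy => [->|]; rewrite ?ts.
rewrite -!cats1 !index_cat yt; have [zt|zt] := boolP (z \in t).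
  by have [] := tP y z yt zt Qy nQz.
by apply: leq_trans (leq_addr _ _); rewrite index_mem.
Qed.

Section Posets.
Variables (T : eqType) (le : rel T).
Hypotheses (le_refl : reflexive le) (le_anti : antisymmetric le).
Hypothesis le_trans : transitive le.
Implicit Types (P : T -> Prop) (a b x y z : T) (s t c : seq T).

Lemma slt_trans : transitive (slt le).
Proof.
move=> y x z /andP[xy lxy] /andP[_ lyz]; rewrite /slt (le_trans lxy lyz) andbT.
by apply: contraNneq xy => E; apply/eqP/le_anti; rewrite lxy E.
Qed.

Lemma covers_le P x y : covers le P x y -> le x y.
Proof. by case=> _ _ /andP[]. Qed.

Lemma bottom_uniq P x y : is_bottom le P x -> is_bottom le P y -> x = y.
Proof. by move=> [Px minx] [Py miny]; apply: le_anti; rewrite minx ?miny. Qed.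

Lemma covers_upper P a x y :
  covers le (upper_interval le P a) x y <-> le a x /\ covers le P x y.
Proof.
split=> [[[Px ax] [Py _] xy min]|[ax [Px Py xy min]]].
  split=> //; split=> // z Pz zP; apply: (min z) => //; split=> //.
  by case: zP => /andP[_ xz] _; apply: le_trans xz.
split=> // [|z [Pz _]]; last exact: min.
by split=> //; case/andP: xy => _; apply: le_trans.
Qed.

(* When every atom ordering of every interval [a, 1] is recursive, condition (i)
   holds after moving the atoms covering an earlier atom to the front. *)
Lemma RAO_of_upper P s0 s : (forall x, P x -> x \in s0) ->
    enumerates_atoms le P s ->
    (forall a t, a \in s -> enumerates_atoms le (upper_interval le P a) t ->
       recursive_atom_ordering le (upper_interval le P a) t) ->
    (forall a b, before s a b ->
       exists2 c, before s c b &
         forall y, P y -> le a y -> le b y ->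
           exists z, [/\ covers le P c z, covers le P b z & le z y]) ->
  recursive_atom_ordering le P s.
Proof.
move=> s0P sP raoP iiP; apply: RAO_step => // a as_.
have [t0 [Ut0 t0P]] :=
  classical_filter s0 (is_atom le (upper_interval le P a)).
have [t [Ut tt0 tP]] := classical_partition (covers_earlier le P s a) Ut0.
exists t => //; apply: raoP => //; split=> // x; rewrite tt0; split=> [/t0P[]//|ax].
by apply/t0P; split=> //; apply: s0P; case: ax => b _ [_ []].
Qed.

(** Birkhoff's condition, with [w] the join of [x] and [y]; in a finite lattice it amounts to upper
    semimodularity. *)
Definition semimodular P : Prop := forall z x y,
  covers le P z x -> covers le P z y -> x <> y ->
  exists w, [/\ covers le P x w, covers le P y w &
                forall u, P u -> le x u -> le y u -> le w u].

Lemma semimodular_upper P a : semimodular P -> semimodular (upper_interval le P a).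
Proof.
move=> smP z x y /covers_upper[az zx] /covers_upper[_ zy] xy.
have [w [xw yw minw]] := smP z x y zx zy xy.
have ax := le_trans az (covers_le zx); have ay := le_trans az (covers_le zy).
by exists w; split=> [||u [Pu _]]; [exact/covers_upper.. | exact: minw].
Qed.

(** Two atoms cover the bottom, so their join covers both and condition (ii) holds with the earlier
    atom itself. Condition (i) follows by induction, since upper intervals inherit
    semimodularity. *)
Lemma semimodular_RAO P s0 s : (forall x, P x -> x \in s0) -> semimodular P ->
  enumerates_atoms le P s -> recursive_atom_ordering le P s.
Proof.
have [m] := ubnP (size s0); elim: m P s0 s => // m IH P s0 s s0m s0P smP sP.
apply: (RAO_of_upper s0P sP) => [a t as_|a b].
  have [b [Pb _] [_ Pa /andP[ba lba] _]] := (sP.2 a).1 as_.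
  (* The interval above an atom misses the bottom [b], so a shorter list contains it. *)
  apply: (IH _ (filter (predC1 b) s0)); last exact: semimodular_upper.
    rewrite -ltnS; apply: leq_trans s0m; rewrite ltnS size_filter.
    rewrite -(count_predC (pred1 b) s0) -[X in X < _]add0n ltn_add2r.
    by rewrite -has_count has_pred1 s0P.
  move=> x [Px ax]; rewrite mem_filter s0P //= andbT.
  by apply: contraNneq ba => E; apply/eqP/le_anti; rewrite lba -E.
move=> [as_ bs ab].
have [p bp pa] := (sP.2 a).1 as_; have [q bq qb] := (sP.2 b).1 bs.
rewrite -(bottom_uniq bp bq) in qb.
have [|w [aw bw minw]] := smP p a b pa qb; first by move=> E; rewrite E ltnn in ab.
by exists a => // y Py ay by_; exists w; split=> //; apply: minw.
Qed.

(** A maximal chain runs from the bottom to the top through covers, and [r] grows by one at each. *)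
Lemma maximal_chain_size P (r : T -> nat) b d c :
    is_bottom le P b -> is_top le P d ->
    (forall x y, covers le P x y -> r y = (r x).+1) ->
  maximal_chain le P c -> size c = (r d - r b).+1.
Proof.
move=> [Pb minb] [Pd maxd] rP [c_sorted cP c_max].
have bc : b \in c by apply: c_max => // y /cP /minb; left.
have dc : d \in c by apply: c_max => // y /cP /maxd; right.
have c0 : 0 < size c by case: (c) bc.
have ltc i j : i < j -> j < size c -> slt le (nth b c i) (nth b c j).
  by move=> ij jc; apply: sorted_ltn_nth => //; rewrite ?inE ?(ltn_trans ij jc) //; exact: slt_trans.
have lec i j : i <= j -> j < size c -> le (nth b c i) (nth b c j).
  by rewrite leq_eqVlt => /predU1P[-> //|ij] /(ltc _ _ ij)/andP[].
have Pnth i : i < size c -> P (nth b c i) by move=> /(mem_nth b)/cP.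
have nth0 : nth b c 0 = b.
  case/(nthP b): (bc) => k kc kb; apply: le_anti; rewrite (minb _ (Pnth _ c0)).
  by rewrite andbT -[X in le _ X]kb lec.
have nthl : nth b c (size c).-1 = d.
  have lc : (size c).-1 < size c by rewrite ltn_predL.
  case/(nthP b): (dc) => k kc kb; apply: le_anti; rewrite (maxd _ (Pnth _ lc)).
  by rewrite -[X in le X _]kb lec // -ltnS prednK.
have cov i : i.+1 < size c -> covers le P (nth b c i) (nth b c i.+1).
  move=> ic; split; [exact/Pnth/ltnW | exact: Pnth | exact: ltc | move=> z Pz [iz zi]].
  (* An element strictly between two neighbours of the chain is comparable to the whole chain, so by
     maximality it belongs to the chain, which is absurd. *)
  have cmp k : k < size c -> k <= i /\ slt le (nth b c k) z \/
                             i < k /\ slt le z (nth b c k).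
    move=> kc; have [ki|ik] := leqP k i; [left | right]; split=> //.
      move: ki; rewrite leq_eqVlt => /predU1P[-> //|ki].
      by apply: slt_trans iz; apply: ltc => //; apply: ltnW.
    move: ik; rewrite leq_eqVlt => /predU1P[<- //|ik].
    by apply: slt_trans zi _; apply: ltc.
  have : z \in c.
    apply: c_max => // y /(nthP b)[k kc <-].
    by case: (cmp k kc) => -[_ /andP[_]]; [right | left].
  by case/(nthP b)=> k kc kz; case: (cmp k kc) => -[_]; rewrite kz /slt eqxx.
have rk i : i < size c -> r (nth b c i) = r b + i.
  elim: i => [|i IH] ic; first by rewrite nth0 addn0.
  by rewrite (rP _ _ (cov i ic)) IH ?addnS // ltnW.
by rewrite -nthl rk ?ltn_predL // addKn prednK.
Qed.

End Posets.

(** * The lcm-lattice of an edge ideal *)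

Section Monomials.
Variable n : nat.

Lemma lem_refl : reflexive (@lem n). Proof. exact: lepm_refl. Qed.

Lemma lem_trans : transitive (@lem n).
Proof. by move=> m2 m1 m3; apply: lepm_trans. Qed.

Lemma lem_anti : antisymmetric (@lem n).
Proof.
move=> m1 m2 /andP[/mnm_lepP le12 /mnm_lepP le21]; apply/mnmP=> i.
by apply/eqP; rewrite eqn_leq le12 le21.
Qed.

(** If no generator divided [m], every multiple of a generator would have coefficient 0 at [m]. *)
Lemma ideal_gen_monomial (k : fieldType) (M : 'X_{1..n} -> Prop) m :
  ideal_gen (monomials_of (k := k) M) 'X_[m] -> exists2 g, M g & (g <= m)%MM.
Proof.
case=> r [c [g [Mg Xm]]]; apply: NNPP => nex.
have : (('X_[m] : {mpoly k[n]})@_m = 0)%R.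
  rewrite Xm GRing.raddf_sum /= big1 // => i _; have [q Mq ->] := Mg i.
  apply/eqP; rewrite mcoeff_eq0 (perm_mem (msuppMX _ _)).
  apply/mapP=> -[d _ mE]; apply: nex; exists q => //.
  by rewrite mE ?lem_addr // lem_addl.
by apply/eqP; rewrite mcoeffX eqxx GRing.oner_neq0.
Qed.
End Monomials.

(** * Squarefree monomials as vertex sets *)

Section SquareFree.
Variable V : finType.
Implicit Types (A B U W : {set V}) (u v w : V).

Definition sqfree U : 'X_{1..#|V|} :=
  [multinom (enum_val i \in U : nat) | i < #|V|].

Lemma lem_sqfree U W : lem (sqfree U) (sqfree W) = (U \subset W).
Proof.
apply/mnm_lepP/subsetP=> [H v vU|UW i].
  by have := H (enum_rank v); rewrite !mnmE enum_rankK vU; case: (v \in W).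
by rewrite !mnmE; case: (boolP (_ \in U)) => // /UW ->.
Qed.

Lemma sqfree_inj : injective sqfree.
Proof.
by move=> U W E; apply/eqP; rewrite eqEsubset -!lem_sqfree E !lem_refl.
Qed.

Lemma mdeg_sqfree U : mdeg (sqfree U) = #|U|.
Proof.
rewrite mdegE -sum1_card (reindex _ (onW_bij _ (enum_val_bij V))) [RHS]big_mkcond.
by apply: eq_bigr => i _; rewrite mnmE; case: (_ \in U).
Qed.

Lemma sqfree0 : sqfree set0 = 0%MM.
Proof. by apply/mnmP=> i; rewrite !mnmE inE. Qed.

Lemma sqfree_eq0 U : (sqfree U == 0%MM) = (U == set0).
Proof. by rewrite -sqfree0 (inj_eq sqfree_inj). Qed.

Lemma sqfreeU U W : sqfree (U :|: W) = mlcm (sqfree U) (sqfree W).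
Proof.
by apply/mnmP=> i; rewrite !mnmE inE; case: (_ \in U); case: (_ \in W).
Qed.

Lemma sqfree2 u v : u != v ->
  sqfree [set u; v] = (U_(enum_rank u) + U_(enum_rank v))%MM.
Proof.
move=> uv; apply/mnmP=> i; rewrite !mnmE !inE.
have E w : (enum_val i == w) = (enum_rank w == i).
  by rewrite -(inj_eq enum_rank_inj) enum_valK eq_sym.
rewrite !E; have [<-|//] := eqVneq (enum_rank u) i.
by rewrite (inj_eq enum_rank_inj) eq_sym (negbTE uv).
Qed.

Lemma slt_sqfree U W : slt (@lem _) (sqfree U) (sqfree W) = (U \proper W).
Proof. by rewrite /slt lem_sqfree (inj_eq sqfree_inj) properEneq. Qed.
End SquareFree.

(** * Edges and vertex sets without isolated vertices *)

Section EdgeIdeal.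
Variables (V : finType) (e : rel V).
Hypotheses (e_sym : ssrbool.symmetric e) (e_irr : irreflexive e).
Variable k : fieldType.
Implicit Types (A B U W Z : {set V}) (u v w x y : V).

Definition edges : {set {set V}} :=
  [set A | [exists u, [exists v, e u v && (A == [set u; v])]]].

(** These sets, the empty one included, are exactly the unions of edges. *)
Definition no_isolated U := [forall u in U, [exists v in U, e u v]].

Local Notation L := (lcm_lattice (edge_ideal k e)).
Local Notation le := (@lem #|V|).

Lemma edge_neq u v : e u v -> u != v.
Proof. by apply: contraTneq => ->; rewrite e_irr. Qed.

Lemma edgesP A : reflect (exists u v, e u v /\ A = [set u; v]) (A \in edges).
Proof.
rewrite inE; apply: (iffP existsP) => [[u /existsP[v /andP[uv /eqP->]]]|].
  by exists u, v.
by case=> u [v [uv ->]]; exists u; apply/existsP; exists v; rewrite uv eqxx.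
Qed.

Lemma edges2 u v : ([set u; v] \in edges) = e u v.
Proof.
apply/edgesP/idP=> [[x [y [xy E]]]|uv]; last by exists u, v.
have ne := edge_neq xy.
have : x \in [set u; v] by rewrite E set21.
have : y \in [set u; v] by rewrite E set22.
by rewrite !in_set2 => /orP[]/eqP Ey /orP[]/eqP Ex; move: xy ne;
  rewrite Ex Ey ?eqxx // e_sym.
Qed.

Lemma card_edge A : A \in edges -> #|A| = 2.
Proof. by case/edgesP=> u [v [/edge_neq uv ->]]; rewrite cards2 uv. Qed.

Lemma no_isolatedP U :
  reflect (forall u, u \in U -> exists2 v, v \in U & e u v) (no_isolated U).
Proof.
apply: (iffP forall_inP) => H u /H; first by case/exists_inP=> v; exists v.
by case=> v vU uv; apply/exists_inP; exists v.
Qed.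

Lemma no_isolatedU U W : no_isolated U -> no_isolated W -> no_isolated (U :|: W).
Proof.
move=> /no_isolatedP gU /no_isolatedP gW; apply/no_isolatedP=> u.
by rewrite inE => /orP[/gU|/gW] [v vU uv]; exists v; rewrite // inE vU ?orbT.
Qed.

Lemma no_isolated0 : no_isolated set0.
Proof. by apply/no_isolatedP=> u; rewrite inE. Qed.

Lemma no_isolated_edge A : A \in edges -> no_isolated A.
Proof.
case/edgesP=> u [v [uv ->]]; apply/no_isolatedP=> w.
rewrite !inE => /orP[]/eqP->; [exists v | exists u]; rewrite ?set21 ?set22 //.
by rewrite e_sym.
Qed.

Lemma no_isolated_edge_sub U u : no_isolated U -> u \in U ->
  exists2 A, A \in edges & u \in A /\ A \subset U.
Proof.
move=> /no_isolatedP gU uU; have [v vU uv] := gU u uU.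
exists [set u; v]; rewrite ?edges2 // set21; split=> //.
by apply/subsetP=> w; rewrite !inE => /orP[]/eqP->.
Qed.

(** All generators have degree 2, so none properly divides another. *)
Lemma edge_min_gensP m :
  min_gens (edge_ideal k e) m <-> exists2 A, A \in edges & m = sqfree A.
Proof.
pose M (m : 'X_{1..#|V|}) := exists2 A, A \in edges & m = sqfree A.
have IM p : edge_ideal k e p <-> ideal_gen (monomials_of M) p.
  split=> -[r [c [g [Sg pE]]]]; exists r, c, g; split=> // i.
    have [u [v [uv ->]]] := Sg i.
    exists (sqfree [set u; v]); first by exists [set u; v]; rewrite ?edges2.
    by rewrite sqfree2 ?edge_neq // mpolyXD.
  have [m' [A /edgesP[u [v [uv ->]]] ->] ->] := Sg i.
  by exists u, v; rewrite sqfree2 ?edge_neq // mpolyXD.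
split; first exact: (min_gensP IM).2.
case=> A eA ->; split=> [|m' /IM/ideal_gen_monomial[g [B eB ->] le1] le2].
  apply/IM; exists 1, (fun=> 1%R), (fun=> 'X_[sqfree A]%R); split=> [_|].
    by exists (sqfree A) => //; exists A.
  by rewrite big_ord1 GRing.mul1r.
have : B \subset A by rewrite -lem_sqfree; apply: lem_trans le1 le2.
rewrite subEproper => /predU1P[E|/proper_card]; last by rewrite !card_edge.
by apply: lem_anti; rewrite le2 -E.
Qed.

(** Least common multiples correspond to unions, and a set without isolated vertices is the union of
    the edges inside it. *)
Lemma lcm_latticeP m : L m <-> exists2 U, no_isolated U & m = sqfree U.
Proof.
split=> [[s s_gens ->]|[U gU ->]].
  elim: s s_gens => [|g s IH] s_gens.
    by exists set0; rewrite ?no_isolated0 // big_nil sqfree0.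
  have [|U gU E] := IH; first by move=> h hs; apply: s_gens; rewrite inE hs orbT.
  have /edge_min_gensP[A eA ->] := s_gens g (mem_head g s).
  exists (A :|: U); last by rewrite big_cons E sqfreeU.
  exact: no_isolatedU (no_isolated_edge eA) gU.
pose s := enum [set A in edges | A \subset U].
exists (map (@sqfree V) s) => [g /mapP[A]|].
  rewrite mem_enum inE => /andP[eA _] ->; apply/edge_min_gensP; by exists A.
rewrite big_map -(big_morph (@sqfree V) (@sqfreeU V) (sqfree0 V)) big_enum /=.
congr sqfree; apply/setP=> u; apply/idP/bigcupP=> [|[A]].
  case/(no_isolated_edge_sub gU)=> A eA [uA AU].
  by exists A => //; rewrite inE eA.
by rewrite inE => /andP[_ /subsetP]; apply.
Qed.

Lemma lcm_lattice_sqfree U : L (sqfree U) <-> no_isolated U.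
Proof.
by split=> [/lcm_latticeP[W gW /sqfree_inj->]|gU] //; apply/lcm_latticeP; exists U.
Qed.

Lemma lcm_lattice_finite m : L m -> m \in map (@sqfree V) (enum {set V}).
Proof. by case/lcm_latticeP=> U _ ->; rewrite map_f // mem_enum. Qed.

Lemma lcm_lattice_bottom : is_bottom le L 0%MM.
Proof.
split=> [|m _]; first by rewrite -sqfree0 lcm_lattice_sqfree no_isolated0.
by apply/mnm_lepP=> i; rewrite mnm0E.
Qed.

Lemma lcm_lattice_top : exists m, is_top le L m.
Proof.
exists (sqfree [set u | [exists v, e u v]]); split=> [|_ /lcm_latticeP[U gU ->]].
  apply/lcm_lattice_sqfree/no_isolatedP=> u; rewrite inE => /existsP[v uv].
  by exists v; rewrite // inE; apply/existsP; exists u; rewrite e_sym.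
rewrite lem_sqfree; apply/subsetP=> u /(no_isolatedP _ gU)[v _ uv].
by rewrite inE; apply/existsP; exists v.
Qed.

(** A nonempty set without isolated vertices contains an edge, and by cardinality an edge contains
    no smaller such set. *)
Lemma lcm_lattice_atomP m :
  is_atom le L m <-> exists2 A, A \in edges & m = sqfree A.
Proof.
have bot := lcm_lattice_bottom.
split=> [[b b_bot [_ /lcm_latticeP[U gU ->] lt min]]|[A eA ->]].
  move: lt min; rewrite (bottom_uniq (@lem_anti _) b_bot bot) => lt min.
  have [U0|[u /(no_isolated_edge_sub gU)[A eA [uA AU]]]] := set_0Vmem U.
    by rewrite U0 sqfree0 /slt eqxx in lt.
  exists A => //; move: AU; rewrite subEproper => /predU1P[-> //|AU].
  case: (min (sqfree A)); first exact/lcm_lattice_sqfree/no_isolated_edge.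
  rewrite slt_sqfree AU -sqfree0 slt_sqfree proper0; split=> //.
  by apply/set0Pn; exists u.
exists 0%MM => //; split; first exact: bot.1.
- exact/lcm_lattice_sqfree/no_isolated_edge.
- by rewrite -sqfree0 slt_sqfree proper0 -card_gt0 card_edge.
move=> _ /lcm_latticeP[U gU ->]; rewrite -sqfree0 !slt_sqfree proper0 => -[/set0Pn[u]].
case/(no_isolated_edge_sub gU)=> B eB [_ /subset_leq_card le_B] /proper_card lt_A.
by have := leq_ltn_trans le_B lt_A; rewrite !card_edge.
Qed.

Lemma covers_add_vertex U w : no_isolated U -> no_isolated (w |: U) -> w \notin U ->
  covers le L (sqfree U) (sqfree (w |: U)).
Proof.
move=> gU gwU wU; split; [exact/lcm_lattice_sqfree.. | |].
  by rewrite slt_sqfree; apply: properUr; rewrite sub1set.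
move=> _ /lcm_latticeP[Z _ ->]; rewrite !slt_sqfree => -[/proper_card lt1 /proper_card].
by rewrite cardsU1 wU; lia.
Qed.
End EdgeIdeal.

(** * The equivalence *)

(** In the trivial case every atom is the top, so no atom precedes another and condition (ii) is
    vacuous. *)
Lemma recursive_atom_ordering_cond (T : eqType) (le : rel T) (P : T -> Prop) s :
    antisymmetric le -> recursive_atom_ordering le P s ->
  enumerates_atoms le P s /\
  forall a b, before s a b -> exists2 c, before s c b &
    forall y, P y -> le a y -> le b y ->
      exists z, [/\ covers le P c z, covers le P b z & le z y].
Proof.
move=> le_anti; case=> {}P {}s // sP P01; split=> // a b [as_ bs ab].
have topP c : c \in s -> is_top le P c.
  move=> cs; have [q [Pq minq] [_ Pc /andP[qc lqc] _]] := (sP.2 c).1 cs.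
  case: (P01 c Pc) => // -[_ minc]; case/eqP: qc.
  by apply: le_anti; rewrite lqc minc.
have [[Pa maxa] [Pb maxb]] := (topP a as_, topP b bs).
by rewrite (le_anti a b) ?ltnn ?maxa ?maxb in ab.
Qed.

Section Main.
Variables (V : finType) (e : rel V).
Hypotheses (e_sym : ssrbool.symmetric e) (e_irr : irreflexive e).
Variable k : fieldType.
Implicit Types (A B U W Z : {set V}) (u v w : V).

Local Notation L := (lcm_lattice (edge_ideal k e)).
Local Notation le := (@lem #|V|).
Let le_refl := @lem_refl #|V|.
Let le_anti := @lem_anti #|V|.
Let le_trans := @lem_trans #|V|.

Lemma compl_graph_sym : ssrbool.symmetric (compl_graph e).
Proof. by move=> u v; rewrite /compl_graph eq_sym e_sym. Qed.

Lemma compl_graph_irr : irreflexive (compl_graph e).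
Proof. by move=> u; rewrite /compl_graph eqxx. Qed.

(** * From a recursive atom ordering to cochordality *)

Section CochordalOfShellable.
Hypothesis L_graded : degree_graded (edge_ideal k e).
Variable s : seq 'X_{1..#|V|}.
Hypothesis s_rao : recursive_atom_ordering le L s.

(** A set that is not an edge gets the default [size s], later than every edge. *)
Let tau A := index (sqfree A) s.

Lemma mem_atom_ordering A : (sqfree A \in s) = (A \in edges e).
Proof.
have [[_ sP] _] := recursive_atom_ordering_cond le_anti s_rao.
apply/idP/idP=> [/sP/(lcm_lattice_atomP e_sym e_irr k)[B eB /sqfree_inj->] //|eA].
by apply/sP/(lcm_lattice_atomP e_sym e_irr k); exists A.
Qed.

(* Degree-gradedness forces the element [z] of condition (ii) to have degree 3,
   so that the earlier atom meets both edges. *)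
Lemma earlier_crossing_edge x y u v :
    [disjoint [set x; y] & [set u; v]] ->
    tau [set x; y] < tau [set u; v] -> tau [set u; v] < size s ->
  exists a b, [/\ a \in [set x; y], b \in [set u; v] &
                  tau [set a; b] < tau [set u; v]].
Proof.
set A := [set x; y]; set B := [set u; v] => disjAB ltAB ltB.
have [_ rao2] := recursive_atom_ordering_cond le_anti s_rao.
have Bs : sqfree B \in s by rewrite -index_mem.
have As : sqfree A \in s by rewrite -index_mem (ltn_trans ltAB).
have [c [cs _ cB] cP] := rao2 _ _ (And3 As Bs ltAB).
have [eA eB] : A \in edges e /\ B \in edges e by rewrite -!mem_atom_ordering.
have [C eC cE] : exists2 C, C \in edges e & c = sqfree C.
  have [[_ sP] _] := recursive_atom_ordering_cond le_anti s_rao.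
  exact/(lcm_lattice_atomP e_sym e_irr k)/sP.
rewrite {}cE in cs cB cP.
have [||| z [Cz Bz lez]] := cP (sqfree (A :|: B)).
- by apply/(lcm_lattice_sqfree e_sym e_irr k); rewrite no_isolatedU ?no_isolated_edge.
- by rewrite lem_sqfree subsetUl.
- by rewrite lem_sqfree subsetUr.
have [/(lcm_latticeP e_sym e_irr k)[Z gZ zE] leCZ] : L z /\ lem (sqfree C) z.
  by split; [case: Cz | exact: covers_le Cz].
have leBZ := covers_le Bz; rewrite {}zE !lem_sqfree in Bz lez leCZ leBZ *.
have cardZ : #|Z| = 3.
  rewrite -(mdeg_sqfree Z) -[2]/(1.+1) -(card_edge e_irr eB) -(mdeg_sqfree B).
  apply: L_graded Bz; apply/eqP; rewrite sqfree_eq0 -card_gt0.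
    by rewrite (card_edge e_irr eB).
  by apply: leq_trans (subset_leq_card leBZ); rewrite (card_edge e_irr eB).
(* The union of [C] and [B] lies in [Z], which has three elements, so the distinct edges [C] and [B]
   share a vertex [c']. The other vertex [d] of [C] is then in [A], as [Z] is contained in
   [A :|: B]. *)
have [d [c' [eE dB c'B]]] : exists d c', [/\ C = [set d; c'], d \notin B & c' \in B].
  have le3 : #|C :|: B| <= 3.
    by rewrite -cardZ; apply: subset_leq_card; rewrite subUset leCZ.
  have neCB : C != B by apply: contraTneq cB => ->; rewrite ltnn.
  have : ~~ (C \subset B).
    by apply: contra neCB => CB; rewrite eqEcard CB !(card_edge e_irr).
  case/subsetPn=> d dC dB.
  have : C :&: B != set0.
    apply: contraTneq le3 => CB0; have := cardsUI C B.
    by rewrite CB0 cards0 addn0 (card_edge e_irr eC) (card_edge e_irr eB) => ->.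
  case/set0Pn=> c'; rewrite inE => /andP[c'C c'B].
  exists d, c'; split=> //; apply/esym/eqP; rewrite eqEcard (card_edge e_irr eC) cards2.
  rewrite (_ : d != c') ?andbT; last by apply: contraNneq dB => ->.
  by apply/subsetP=> w; rewrite !inE => /orP[]/eqP->.
exists d, c'; rewrite -eE; split=> //.
have : d \in A :|: B by apply: (subsetP lez); apply: (subsetP leCZ); rewrite eE set21.
by rewrite inE (negbTE dB) orbF.
Qed.

(** In an induced cycle of the complement the chords are edges of the graph and the sides are not,
    so under [tau] all chords precede all sides. *)
Lemma cochordal_of_atom_ordering : cochordal e.
Proof.
move=> c c4 c_ind; have [x0 x0c] : exists x0, x0 \in c.
  by case: (c) c4 => // x0 l _; exists x0; rewrite mem_head.
have Uc := c_ind.1.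
have /(induced_cycle_nthP x0 compl_graph_sym compl_graph_irr Uc (ltnW c4)) adjE := c_ind.
have tauE u v : (tau [set u; v] < size s) = e u v.
  by rewrite index_mem mem_atom_ordering edges2.
have tau_le A : tau A <= size s by apply: index_size.
have chordN i j : i < j -> j < size c -> ~~ cyc_adj (size c) i j ->
    tau [set nth x0 c i; nth x0 c j] < size s.
  move=> ij jc; rewrite -adjE // tauE negb_and negbK nth_uniq ?(ltn_trans ij) //.
  by rewrite (ltn_eqF ij) => /negPn.
apply: (chords_before_sides (tau := tau) (N := size s) (n := size c)
          (f := nth x0 c)) => //.
- move=> A B ltA E; apply: sqfree_inj.
  by rewrite -(nth_index 0%MM (s := s) (x := sqfree A)) -?index_mem // -/(tau A) E
             nth_index // -index_mem -/(tau B) -E.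
- exact: earlier_crossing_edge.
- by move=> i j ic jc /eqP; rewrite nth_uniq // => /eqP.
move=> i j i' j' ij jc nadj ij' jc' adj'.
apply: leq_trans (chordN i j ij jc nadj) _; rewrite leqNgt tauE.
by move: adj'; rewrite -adjE // => /andP[].
Qed.
End CochordalOfShellable.

(** * From a perfect elimination ordering to degree-gradedness and shellability *)

Section ShellableOfCochordal.

(** This is the contrapositive of perfect elimination in the complement: if [x] is joined to neither
    of the later vertices [y] and [z], then [y] and [z] are not joined. *)
Lemma cochordal_peo : cochordal e -> exists p : seq V, (forall x, x \in p) /\
  forall x y z, index x p < index y p -> index x p < index z p -> e y z ->
    e x y || e x z.
Proof.
move=> e_cochordal; have [p [_ pT pP]] :=
  chordal_peo [set: V] compl_graph_sym compl_graph_irr e_cochordal.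
exists p; split=> [x|x y z xy xz yz]; first by rewrite pT inE.
apply/negPn; rewrite negb_or; apply/negP=> /andP[nxy nxz].
have ne u v : index u p < index v p -> u != v.
  by apply: contraTneq => ->; rewrite ltnn.
have := pP x y z; rewrite !inE /compl_graph (ne x y) ?(ne x z) // nxy nxz yz andbF.
by move=> /(_ isT isT isT xy xz isT isT (edge_neq e_irr yz)).
Qed.

Variable p : seq V.
Hypothesis p_total : forall x, x \in p.
Hypothesis p_peo : forall x y z, index x p < index y p -> index x p < index z p ->
  e y z -> e x y || e x z.

Definition first_index A := find (mem A) p.

Lemma first_index_le A x : x \in A -> first_index A <= index x p.
Proof.
move=> xA; rewrite leqNgt; apply/negP=> /(before_find x).
by rewrite nth_index //= => /negP.
Qed.

Lemma first_index_attained A : A \in edges e ->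
  exists2 x, x \in A & index x p = first_index A.
Proof.
case/edgesP=> u [v [_ AE]]; have uA : u \in A by rewrite AE set21.
have hasA : has (mem A) p by apply/hasP; exists u.
have xA := nth_find u hasA; exists (nth u p (first_index A)) => //.
apply/eqP; rewrite eqn_leq first_index_le // andbT.
by rewrite leqNgt; apply/negP=> /(before_find u); rewrite /= eqxx.
Qed.

(** Both ends of [B] come after the first vertex [x] of [A], so the elimination property joins [x]
    to one of them. *)
Lemma first_vertex_adjacent A B : A \in edges e -> B \in edges e ->
    [disjoint A & B] -> first_index A <= first_index B ->
  exists x b, [/\ x \in A, b \in B, e x b, index x p = first_index A &
                  first_index A < first_index B].
Proof.
move=> eA eB disj leAB; have [x xA xE] := first_index_attained eA.
have [y yB yE] := first_index_attained eB.
have ltAB : first_index A < first_index B.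
  rewrite ltn_neqAle leAB andbT -xE -yE; apply/eqP=> E.
  have xy : x = y by rewrite -(nth_index x (p_total x)) E nth_index.
  by have := disjointFr disj xA; rewrite xy yB.
have lt_x w : w \in B -> index x p < index w p.
  by move=> wB; rewrite xE (leq_trans ltAB) // first_index_le.
case/edgesP: (eB) => u [v [uv BE]].
have [uB vB] : u \in B /\ v \in B by rewrite BE set21 set22.
by case/orP: (p_peo (lt_x u uB) (lt_x v vB) uv) => ex; exists x;
  [exists u | exists v].
Qed.

Lemma crossing_edge A B : A \in edges e -> B \in edges e -> [disjoint A & B] ->
  exists a b, [/\ a \in A, b \in B & e a b].
Proof.
move=> eA eB disj; have [leAB|/ltnW leBA] := leqP (first_index A) (first_index B).
  by have [x [b [xA bB xb _ _]]] := first_vertex_adjacent eA eB disj leAB; exists x, b.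
rewrite disjoint_sym in disj.
have [x [a [xB aA xa _ _]]] := first_vertex_adjacent eB eA disj leBA.
by exists a, x; rewrite e_sym.
Qed.

(** A vertex [w] of [W] outside [U] has a neighbour [w'] in [W]. If [w'] is in [U], then [w] can be
    added; otherwise the edge they form is disjoint from an edge inside [U], and a crossing edge
    attaches one of its ends to [U]. *)
Lemma add_vertex U W : no_isolated e U -> no_isolated e W -> U != set0 ->
  U \proper W -> exists w, [/\ w \in W, w \notin U & no_isolated e (w |: U)].
Proof.
move=> gU gW /set0Pn[u uU] /properP[_ [w wW wU]].
have add a b : a \in U -> e a b -> no_isolated e (b |: U).
  move=> aU ab; apply/no_isolatedP=> x; rewrite !inE => /predU1P[->|xU].
    by exists a; rewrite ?inE ?aU ?orbT // e_sym.
  by have [y yU xy] := no_isolatedP _ _ gU x xU; exists y; rewrite // inE yU orbT.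
have [w' w'W ww'] := no_isolatedP _ _ gW w wW.
have [w'U|w'U] := boolP (w' \in U).
  by exists w; split=> //; apply: (add w'); rewrite // e_sym.
have [A eA [_ AU]] := no_isolated_edge_sub e_sym e_irr gU uU.
have [||a [b [aA bww' ab]]] := crossing_edge eA (B := [set w; w']).
- by rewrite edges2.
- rewrite disjoint_sym disjoints_subset; apply/subsetP=> x.
  by rewrite !inE => /orP[]/eqP->; [apply: contra wU | apply: contra w'U];
     apply: (subsetP AU).
have gb := add a b (subsetP AU a aA) ab.
by move: bww'; rewrite !inE => /orP[]/eqP bE; exists b; rewrite {1 2}bE; split.
Qed.

Lemma covers_nonzeroP z x : covers le L z x -> z <> 0%MM ->
  exists U w, [/\ no_isolated e U, no_isolated e (w |: U), w \notin U,
                  z = sqfree U & x = sqfree (w |: U)].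
Proof.
case=> /(lcm_latticeP e_sym e_irr k)[U gU ->] /(lcm_latticeP e_sym e_irr k)[W gW ->].
rewrite slt_sqfree => UW min /eqP; rewrite sqfree_eq0 => U0.
have [w [wW wU gwU]] := add_vertex gU gW U0 UW.
exists U, w; split=> //; have wUW : w |: U \subset W.
  by rewrite subUset sub1set wW proper_sub.
move: wUW; rewrite subEproper => /predU1P[-> //|wUW].
case: (min (sqfree (w |: U))); first exact/(lcm_lattice_sqfree e_sym e_irr k).
by rewrite !slt_sqfree wUW properUr // sub1set.
Qed.

Lemma lcm_lattice_degree_graded : d_degree_graded 2 (edge_ideal k e).
Proof.
split=> [a b a0 _ /covers_nonzeroP /(_ a0)[U [w [_ _ wU -> ->]]]|].
  by rewrite !mdeg_sqfree cardsU1 wU.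
move=> a /(lcm_lattice_atomP e_sym e_irr k)[A eA ->].
by rewrite mdeg_sqfree (card_edge e_irr eA).
Qed.

(* The rank of a nonzero element is its degree minus one, that of 0 is 0. *)
Lemma lcm_lattice_graded : graded_poset le L.
Proof.
have L_bot := lcm_lattice_bottom e_sym e_irr k.
have [top L_top] := lcm_lattice_top e_sym e_irr k.
have rankP x y : covers le L x y -> (mdeg y).-1 = (mdeg x).-1.+1.
  move=> xy; have [x0|/eqP x0] := eqVneq x 0%MM.
    have /(lcm_lattice_atomP e_sym e_irr k)[A eA ->] : is_atom le L y.
      by exists 0%MM => //; rewrite -x0.
    by rewrite x0 mdeg0 mdeg_sqfree (card_edge e_irr eA).
  have [U [w [_ _ wU xE ->]]] := covers_nonzeroP xy x0.
  rewrite xE !mdeg_sqfree cardsU1 wU prednK // card_gt0 -sqfree_eq0 -xE.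
  exact/eqP.
split; first by exists (map (@sqfree V) (enum {set V})) => m /lcm_lattice_finite;
  apply.
- by exists 0%MM.
- by exists top.
move=> c c'; have size_c := maximal_chain_size le_refl le_anti le_trans L_bot L_top rankP.
by move=> /size_c -> /size_c ->.
Qed.

(** Two covers of a nonzero element add one vertex each to the same set; their join adds both, hence
    one more vertex to either. *)
Lemma semimodular_upper_lcm_lattice a : a <> 0%MM ->
  semimodular le (upper_interval le L a).
Proof.
move=> a0 z x y /(covers_upper le_trans)[az zx] /(covers_upper le_trans)[_ zy] xy.
have z0 : z <> 0%MM.
  move=> z0; apply: a0; apply: le_anti; rewrite -[X in lem a X]z0 az /=.
  by apply/mnm_lepP=> i; rewrite mnm0E.
have ax := le_trans az (covers_le zx); have ay := le_trans az (covers_le zy).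
have [Z [u [gZ guZ uZ zE xE]]] := covers_nonzeroP zx z0.
have [Z' [v [_ gvZ vZ zE' yE]]] := covers_nonzeroP zy z0.
have ZE : Z' = Z by apply: sqfree_inj; rewrite -zE.
rewrite {}ZE in gvZ vZ zE' yE.
have uv : u != v by apply: contra_not_neq xy => E; rewrite xE yE E.
have gW : no_isolated e (u |: (v |: Z)).
  by rewrite -[Z in v |: Z]setUid setUA setUACA no_isolatedU.
exists (sqfree (u |: (v |: Z))); split.
- apply/(covers_upper le_trans); split=> //; rewrite xE setUCA.
  apply: covers_add_vertex => //; first by rewrite setUCA.
  by rewrite !inE eq_sym negb_or uv.
- apply/(covers_upper le_trans); split=> //; rewrite yE.
  by apply: covers_add_vertex => //; rewrite !inE negb_or uv.
move=> _ [/(lcm_latticeP e_sym e_irr k)[W _ ->] _].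
by rewrite xE yE !lem_sqfree subUset => /andP[uW _] vZW; rewrite subUset uW.
Qed.

(** Distinct edges that meet share exactly one vertex, so the union adds a single vertex to [A]. *)
Lemma covers_union_edges A B : A \in edges e -> B \in edges e -> A != B ->
    ~~ [disjoint A & B] ->
  covers le L (sqfree A) (sqfree (A :|: B)).
Proof.
move=> eA eB AB nAB; have [w wB wA] : exists2 w, w \in B & w \notin A.
  apply/subsetPn; apply: contra AB => BA.
  by rewrite eq_sym eqEcard BA !(card_edge e_irr).
have wAE : w |: A = A :|: B.
  apply/eqP; rewrite eqEcard; apply/andP; split.
    by rewrite setUC setUS // sub1set.
  move: nAB; rewrite -setI_eq0 -card_gt0 cardsU1 wA.
  by have := cardsUI A B; rewrite (card_edge e_irr eA) (card_edge e_irr eB); lia.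
rewrite -wAE; apply: covers_add_vertex => //; first exact: no_isolated_edge.
by rewrite wAE no_isolatedU // no_isolated_edge.
Qed.

(** Edges with the same first vertex may come in any order. *)
Definition edge_ordering : seq {set V} :=
  sort (relpre first_index leq) (enum (edges e)).

Lemma mem_edge_ordering A : (A \in edge_ordering) = (A \in edges e).
Proof. by rewrite mem_sort mem_enum. Qed.

Lemma index_edge_ordering A B : A \in edges e -> B \in edges e ->
    (index A edge_ordering < index B edge_ordering -> first_index A <= first_index B) /\
    (first_index A < first_index B -> index A edge_ordering < index B edge_ordering).
Proof.
move=> eA eB.
have mono C D : C \in edges e -> D \in edges e ->
    index C edge_ordering <= index D edge_ordering -> first_index C <= first_index D.
  move=> eC eD leCD; have := @sorted_leq_nth _ (relpre first_index leq) _ _ C edge_ordering.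
  move=> /(_ _ _ _ (index C edge_ordering) (index D edge_ordering)).
  rewrite !inE !index_mem !mem_edge_ordering !nth_index ?mem_edge_ordering //=.
  apply=> //; [by move=> ? ? ?; apply: leq_trans | by move=> ?; apply: leqnn |].
  by apply: sort_sorted => ? ?; apply: leq_total.
split=> [/ltnW|]; first exact: mono.
by rewrite !ltnNge; apply: contra; apply: mono.
Qed.

Lemma lcm_lattice_atom_ordering :
  recursive_atom_ordering le L (map (@sqfree V) edge_ordering).
Proof.
have idx A : index (sqfree A) (map (@sqfree V) edge_ordering) = index A edge_ordering.
  exact/index_map/sqfree_inj.
have memE a : a \in map (@sqfree V) edge_ordering <-> exists2 A, A \in edges e & a = sqfree A.
  split=> [/mapP[A]|[A eA ->]]; first by rewrite mem_edge_ordering; exists A.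
  by rewrite map_f // mem_edge_ordering.
have L_fin := @lcm_lattice_finite _ _ e_sym e_irr k.
apply: (RAO_of_upper L_fin) => [|a t|a b].
- split=> [|a]; first by rewrite (map_inj_uniq (@sqfree_inj V)) sort_uniq enum_uniq.
  split=> [/memE H|/(lcm_lattice_atomP e_sym e_irr k) H]; last exact/memE.
  exact/(lcm_lattice_atomP e_sym e_irr k).
- move=> /memE[A eA ->]; have A0 : sqfree A <> 0%MM.
    by apply/eqP; rewrite sqfree_eq0 -card_gt0 (card_edge e_irr eA).
  apply: (semimodular_RAO le_anti le_trans) (semimodular_upper_lcm_lattice A0).
  by move=> x [/L_fin Lx _]; apply: Lx.
case=> /memE[A eA ->] /memE[B eB ->]; rewrite !idx => ltAB.
(* If [A] meets [B], take [C = A]. Otherwise [C] joins the first vertex of [A] to [B], and it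
   precedes [B] because [B] starts strictly later. As [C] lies in [A :|: B], the union of [C] and
   [B] is below every common upper bound of [A] and [B]. *)
have [C [eC CB ltCB CAB]] : exists C, [/\ C \in edges e, ~~ [disjoint C & B],
    index C edge_ordering < index B edge_ordering & C \subset A :|: B].
  have [disj|ndisj] := boolP [disjoint A & B]; last by exists A; rewrite subsetUl.
  have leAB := (index_edge_ordering eA eB).1 ltAB.
  have [x [w [xA wB xw xE lt]]] := first_vertex_adjacent eA eB disj leAB.
  have eC : [set x; w] \in edges e by rewrite edges2.
  exists [set x; w]; split=> //.
  - by rewrite -setI_eq0; apply/set0Pn; exists w; rewrite !inE eqxx orbT.
  - apply: (index_edge_ordering eC eB).2; apply: leq_ltn_trans lt.
    by rewrite -xE first_index_le // set21.
  by apply/subsetP=> y; rewrite !inE => /orP[]/eqP->; rewrite ?xA ?wB ?orbT.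
have neCB : C != B by apply: contraTneq ltCB => ->; rewrite ltnn.
exists (sqfree C); first by split; rewrite ?idx //; apply/memE; [exists C | exists B].
move=> _ /(lcm_latticeP e_sym e_irr k)[Y _ ->]; rewrite !lem_sqfree => AY BY.
exists (sqfree (C :|: B)); split; first exact: covers_union_edges.
  by rewrite setUC; apply: covers_union_edges; rewrite // 1?eq_sym 1?disjoint_sym.
by rewrite lem_sqfree subUset BY andbT (subset_trans CAB) // subUset AY.
Qed.

End ShellableOfCochordal.
End Main.

Theorem corollary1p2 (V : finType) (e : rel V) (e_sym : ssrbool.symmetric e)
    (e_irr : irreflexive e) (k : fieldType) :
  cochordal e <->
  d_degree_graded 2 (edge_ideal k e) /\
  CL_shellable (@lem #|V|) (lcm_lattice (edge_ideal k e)).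
Proof.
split=> [|[[L_graded _] [_ [s s_rao]]]]; last first.
  exact: (cochordal_of_atom_ordering e_sym e_irr L_graded s_rao).
case/(cochordal_peo e_sym e_irr)=> p [p_total p_peo]; split.
  exact: (@lcm_lattice_degree_graded V e e_sym e_irr k p p_total p_peo).
split; first exact: (@lcm_lattice_graded V e e_sym e_irr k p p_total p_peo).
exists (map (@sqfree V) (edge_ordering e p)).
exact: (@lcm_lattice_atom_ordering V e e_sym e_irr k p p_total p_peo).
Qed.
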